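(* For every integer $n\ge 0$, the set of live cells of the Square-Ulam-Warburton automaton after generation $n$ contains, in each of its four slices, the Sierpinski gasket up to generation $n$. That is, for each of the four slices with its slice coordinates $(x,y)$, every cell with integer coordinates $x,y\ge 0$ such that $x+y\le n$ and $\binom{x+y}{x}$ is odd is live after generation $n$.
   Context: The square grid is the tiling of the plane by unit squares, called cells. Two cells are adjacent (neighbors) if they are distinct and share a side, so each cell has 4 neighbors. The Square-Ulam-Warburton automaton: at generation 0 exactly one cell, the initial cell (the patriarch), is live. For each $n\ge 0$, a cell that is not live after generation $n$ is born in generation $n+1$ (becomes live) if and only if it is adjacent to exactly one cell that is live after generation $n$; all such births happen simultaneously. Live cells never die. Slices: place the center of the initial cell at the origin and let $e_0,\dots,e_3$ be the vectors, in cyclic order, from the origin to the centers of its four neighbors. For $i\in\{0,\dots,3\}$ (indices mod 4), the $i$-th slice (quadrant) is the set of cells with centers $x e_i+y e_{i+1}$ with integers $x,y\ge 0$; $(x,y)$ are the slice coordinates. Neighboring slices share the cells on their common boundary ray. The Sierpinski gasket is regarded as Pascal's triangle modulo 2, row by row: row $m$ ($m\ge 0$) has positions $0,\dots,m$, and position $j$ of row $m$ belongs to the gasket if and only if $\binom{m}{j}$ is odd. Row $m$ is called generation $m$ of the gasket, and the gasket up to generation $n$ consists of rows $0,\dots,n$. The gasket is placed in a slice with its top cell at the initial cell: the cell with slice coordinates $(x,y)$ corresponds to position $x$ of row $x+y$. *)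

(* Defs.v *)
From mathcomp Require Import all_boot all_order all_algebra.
From mathcomp Require Import zify.

Set Implicit Arguments.
Unset Strict Implicit.
Unset Printing Implicit Defensive.

Import GRing.Theory.
Local Open Scope ring_scope.

(* A cell is represented by the coordinates of its center, the initial cell
   being centered at the origin. *)
Definition cell : Type := (int * int)%type.

Definition origin : cell := (0, 0).

(* The vectors e_0, ..., e_3 in cyclic (counterclockwise) order. *)
Definition e (i : 'I_4) : cell :=
  nth origin [:: (1, 0); (0, 1); (-1, 0); (0, -1)] i.

Definition neighbors (c : cell) : seq cell := [seq c + e i | i <- enum 'I_4].

Definition adjacent (c d : cell) : bool := d \in neighbors c.

(* Requiring "not yet live" in the birth clause would be redundant, since live
   cells stay live. *)
Fixpoint live (n : nat) (c : cell) : bool :=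
  if n is m.+1 then live m c || (count (live m) (neighbors c) == 1%N)
  else c == origin.

(* The cell with center x e_i + y e_(i+1), indices mod 4. *)
Definition slice_cell (i : 'I_4) (x y : nat) : cell :=
  e i *+ x + e (ordS i) *+ y.

(* Position j of row m of Pascal's triangle modulo 2. *)
Definition gasket (m j : nat) : bool := (j <= m)%N && odd 'C(m, j).

Lemma e_inj : injective e.
Proof.
by case=> [[|[|[|[|i]]]] Hi] // [[|[|[|[|j]]]] Hj] // _; apply: val_inj.
Qed.

(* Two unit cells of the grid share a side, and are distinct, exactly when their
   centers are at l1-distance 1. *)
Lemma adjacentE (c d : cell) :
  adjacent c d = (`|c.1 - d.1| + `|c.2 - d.2| == 1).
Proof.
case: c d => [a b] [a' b']; rewrite /adjacent /=; apply/mapP/eqP => /=.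
  by case=> [[[|[|[|[|i]]]] Hi] // _ [-> ->]] /=; lia.
move=> H.
have [k Hk]: exists k : 'I_4, (a', b') = (a, b) + e k.
  have [E|[E|[E|E]]] : (a' = a + 1 /\ b' = b + 0) \/ (a' = a + 0 /\ b' = b + 1)
    \/ (a' = a + -1 /\ b' = b + 0) \/ (a' = a + 0 /\ b' = b + -1) by lia.
  - by exists (@Ordinal 4 0 isT); case: E => -> ->.
  - by exists (@Ordinal 4 1 isT); case: E => -> ->.
  - by exists (@Ordinal 4 2 isT); case: E => -> ->.
  - by exists (@Ordinal 4 3 isT); case: E => -> ->.
by exists k; rewrite ?mem_enum.
Qed.

Lemma neighbors_uniq (c : cell) : uniq (neighbors c).
Proof. by rewrite map_inj_uniq ?enum_uniq // => i j /addrI /e_inj. Qed.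

Lemma size_neighbors (c : cell) : size (neighbors c) = 4.
Proof. by rewrite size_map size_enum_ord. Qed.

Lemma liveS (n : nat) (c : cell) :
  live n.+1 c <->
  live n c \/ (~~ live n c /\ exists! d : cell, adjacent c d /\ live n d).
Proof.
have cntP : count (live n) (neighbors c) == 1%N <->
    exists! d : cell, adjacent c d /\ live n d.
  rewrite -size_filter; split.
    case E: (filter _ _) => [|d [|d' s]] //= _.
    have M z : (z \in neighbors c) && live n z = (z == d).
      by rewrite andbC -mem_filter E inE.
    exists d; split; first by apply/andP; rewrite /adjacent M.
    by move=> z [cz lz]; apply/esym/eqP; rewrite -M lz andbT.
  case=> d [[cd ld] U].
  have -> : size [seq z <- neighbors c | live n z] = size [:: d]; last by [].
  apply/perm_size/uniq_perm; rewrite ?filter_uniq ?neighbors_uniq // => z.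
  rewrite mem_filter inE; apply/andP/eqP => [[lz cz]|-> //].
  by apply/esym/U.
rewrite /= -/live; split.
  case/orP => [l|/cntP u]; first by left.
  by case: (boolP (live n c)) => l; [left | right].
by case=> [->|[_ /cntP ->]] //; rewrite orbT.
Qed.

(* Main.v *)
Require Import Defs.
From mathcomp Require Import all_boot all_order all_algebra.
From mathcomp Require Import zify.

(** The automaton advances at unit speed: after generation [n] no cell at
l1-distance more than [n] from the origin is live. Hence, when a cell at
distance [m + 1] is examined for birth in generation [m + 1], the cell and its
neighbors farther out are dead, and it is born if and only if exactly one of
its inner neighbors, at distance [m], is live. In slice coordinates the inner
neighbors of [(x, y)] are [(x - 1, y)] and [(x, y - 1)], and exactly one being
live is the exclusive or, which is Pascal's rule modulo 2. On a boundary ray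
one of these two positions falls into the adjacent slice at distance [m + 2], so
it is dead, in accordance with the zero entries outside Pascal's triangle.

Thus the cells on the wave front, those at distance exactly [m] after
generation [m], are precisely the odd entries of row [m] ([live_front]), and
the theorem follows because live cells never die. *)

Import GRing.Theory.
Local Open Scope ring_scope.

Definition l1norm (c : cell) : nat := (`|c.1| + `|c.2|)%N.

Lemma live_mono (m n : nat) (c : cell) : (m <= n)%N -> live m c -> live n c.
Proof.
move=> /subnK <-; elim: (n - m)%N => [//|k IHk] lc.
by rewrite addSn /= IHk.
Qed.

Lemma live_l1norm (n : nat) (c : cell) : live n c -> (l1norm c <= n)%N.
Proof.
elim: n c => [|n IHn] c; first by move=> /eqP ->.
case/liveS => [/IHn /leqW //|[_ [d [[adj_cd /IHn le_dn] _]]]].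
by move: adj_cd le_dn; rewrite adjacentE /l1norm; lia.
Qed.

Lemma dead_outside (n : nat) (c : cell) : (n < l1norm c)%N -> live n c = false.
Proof. by rewrite ltnNge; apply/contraNF/live_l1norm. Qed.

(** Integer rather than natural coordinates make the neighbors of a boundary
cell that lie outside its slice expressible in the frame of that slice. *)
Definition frame_cell (i : 'I_4) (a b : int) : cell :=
  e i *~ a + e (ordS i) *~ b.

Lemma slice_cellE (i : 'I_4) (x y : nat) : slice_cell i x y = frame_cell i x y.
Proof. by []. Qed.

(** [e i] and [e (ordS i)] are, up to signs and order, the standard basis. *)
Lemma l1norm_frame (i : 'I_4) (a b : int) :
  l1norm (frame_cell i a b) = (`|a| + `|b|)%N.
Proof.
have mulz1 (c : cell) k : (c *~ k).1 = c.1 * k by rewrite (raddfMz fst) mulrzz.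
have mulz2 (c : cell) k : (c *~ k).2 = c.2 * k by rewrite (raddfMz snd) mulrzz.
rewrite /l1norm /frame_cell /= !mulz1 !mulz2.
by case: i => [[|[|[|[|i]]]] Hi] //=; lia.
Qed.

Lemma e_opp (i : 'I_4) : e (ordS (ordS i)) = - e i.
Proof. by case: i => [[|[|[|[|i]]]] Hi]. Qed.

Lemma perm_enum_turns (i : 'I_4) :
  perm_eq (enum 'I_4) [:: i; ordS i; ordS (ordS i); ordS (ordS (ordS i))].
Proof.
apply: (perm_map_inj val_inj); rewrite val_enum_ord.
by case: i => [[|[|[|[|i]]]] Hi].
Qed.

(** Quarter turns carry [e i] through all four unit steps, and a half turn is
the opposite, so the steps are [e i], [e (ordS i)] and their opposites,
whichever slice is considered. *)
Lemma count_neighbors_frame (P : pred cell) (i : 'I_4) (a b : int) :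
  count P (neighbors (frame_cell i a b)) =
  (P (frame_cell i (a + 1) b) + P (frame_cell i a (b + 1))
   + (P (frame_cell i (a - 1) b) + P (frame_cell i a (b - 1))))%N.
Proof.
rewrite /frame_cell !mulrzDr !mulrNz !mulr1z.
rewrite !addrA (addrAC _ (e i)) (addrAC _ (- e i)).
set c := e i *~ a + e (ordS i) *~ b.
by rewrite /neighbors (permP (perm_map _ (perm_enum_turns i))) /=
           !e_opp addn0 !addnA.
Qed.

(** Only the inner neighbors of a cell on the wave front can be live when it
is examined, so its birth rule involves these alone. *)
Lemma live_frontS (m : nat) (i : 'I_4) (a b : int) :
  0 <= a -> 0 <= b -> a + b = m.+1 ->
  live m.+1 (frame_cell i a b) =
  live m (frame_cell i (a - 1) b) (+) live m (frame_cell i a (b - 1)).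
Proof.
move=> a0 b0 abm; rewrite /= -/live count_neighbors_frame.
rewrite (@dead_outside m (frame_cell i a b)) ?l1norm_frame; last by lia.
rewrite (@dead_outside m (frame_cell i (a + 1) b)) ?l1norm_frame; last by lia.
rewrite (@dead_outside m (frame_cell i a (b + 1))) ?l1norm_frame; last by lia.
by do 2 case: (live m _).
Qed.

(** Both sides obey Pascal's rule modulo 2; on a boundary ray the inner
position missing from the slice is dead, like a zero entry of the triangle. *)
Lemma live_front (m : nat) (i : 'I_4) (x y : nat) :
  (x + y)%N = m -> live m (slice_cell i x y) = odd 'C(m, x).
Proof.
rewrite slice_cellE; elim: m x y => [|m IHm] x y xym.
  by have [-> ->] : x = 0%N /\ y = 0%N by lia.
rewrite live_frontS; try lia.
case: x y xym => [|x] [|y] // xym.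
- rewrite dead_outside ?l1norm_frame; last by lia.
  have -> : y.+1%:Z - 1 = y by lia.
  by rewrite IHm ?bin0 //; lia.
- rewrite [X in _ (+) X]dead_outside ?l1norm_frame; last by lia.
  have -> : x.+1%:Z - 1 = x by lia.
  have xm : x = m by lia.
  by rewrite addbF IHm xm ?addn0 // !binn.
- have -> : x.+1%:Z - 1 = x by lia.
  have -> : y.+1%:Z - 1 = y by lia.
  rewrite !IHm; try lia.
  by rewrite binS oddD addbC.
Qed.

Theorem theorem3 (n : nat) (i : 'I_4) (x y : nat) :
  (x + y <= n)%N -> gasket (x + y)%N x -> live n (slice_cell i x y).
Proof.
move=> le_xyn /andP[_ odd_bin].
by apply: live_mono le_xyn _; rewrite (live_front (x + y)).
Qed.
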